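(* Let $d\ge 1$, $\alpha\in(0,1)$, $r,s\ge 0$ with $r+s=\alpha$, $0<q<1$, and let $n_1,n_2\ge 1$ be integers with $n_1+n_2=n$. For every probability distribution $P$ on $\mathbb{R}^d\times\mathbb{R}$ and all locally nondecreasing conformity scores $f^{\mathrm{lo}}$ and $f^{\mathrm{hi}}$, the output $\hat C_n(X_{n+1})$ of the split procedure (described in the context) run on $(X_1,Y_1),\ldots,(X_n,Y_n)$ and $X_{n+1}$, where $(X_1,Y_1),\ldots,(X_{n+1},Y_{n+1})$ are i.i.d. from $P$, satisfies $$\mathbb{P}\{\mathrm{Quantile}_q(Y_{n+1}\mid X_{n+1})\in\hat C_n(X_{n+1})\}\ge 1-\alpha .$$
   Context: $\mathrm{Quantile}_q(Y\mid X=x)$ is a $q$-th quantile of the conditional distribution of $Y$ given $X=x$ under $P$, i.e. a point $u$ with $\mathbb{P}\{Y\le u\mid X=x\}\ge q$ and $\mathbb{P}\{Y\ge u\mid X=x\}\ge 1-q$ (if not unique, a fixed choice, measurable in $x$, is made); $\mathrm{Quantile}_q(Y_{n+1}\mid X_{n+1})$ is this function evaluated at the random point $X_{n+1}$. The probability is over the training data, $X_{n+1}$, and any randomness of the procedure. A function $f:\mathbb{R}^d\times\mathbb{R}\to\mathbb{R}$ is a locally nondecreasing conformity score if $f(x,y)\le f(x,y')$ for all $x\in\mathbb{R}^d$ and all $y\le y'$ in $\mathbb{R}$. Split procedure. Randomly split $\{1,\ldots,n\}$, independently of the data, into disjoint $\mathcal I_1,\mathcal I_2$ with $|\mathcal I_1|=n_1$,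 $|\mathcal I_2|=n_2$. Fit locally nondecreasing conformity scores $f^{\mathrm{lo}},f^{\mathrm{hi}}:\mathbb{R}^d\times\mathbb{R}\to\mathbb{R}$ on $\{(X_i,Y_i):i\in\mathcal I_1\}$ (by any measurable rule using only this subset of the data, possibly with independent randomness). For $i\in\mathcal I_2$ set $E_i^{\mathrm{lo}}=f^{\mathrm{lo}}(X_i,Y_i)$ and $E_i^{\mathrm{hi}}=f^{\mathrm{hi}}(X_i,Y_i)$. Let $Q^{\mathrm{lo}}_{rq}(E)$ be the $(rq(1+1/n_2)-1/n_2)$-th empirical quantile of $\{E_i^{\mathrm{lo}}:i\in\mathcal I_2\}$ and $Q^{\mathrm{hi}}_{1-s(1-q)}(E)$ the $(1-s(1-q))(1+1/n_2)$-th empirical quantile of $\{E_i^{\mathrm{hi}}:i\in\mathcal I_2\}$. Here the $p$-th empirical quantile of $n_2$ numbers is the $\lceil n_2p\rceil$-th smallest, equal to $-\infty$ if $\lceil n_2p\rceil\le 0$ and $+\infty$ if $\lceil n_2 p\rceil>n_2$. Output $$\hat C_n(X_{n+1})=\{y\in\mathbb{R}: Q^{\mathrm{lo}}_{rq}(E)\le f^{\mathrm{lo}}(X_{n+1},y)\ \text{and}\ f^{\mathrm{hi}}(X_{n+1},y)\le Q^{\mathrm{hi}}_{1-s(1-q)}(E)\}.$$ *)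

(* Defs.v *)
(* R^d is [d.-tuple R], carrying the product (= Borel) sigma-algebra. *)
From HB Require Import structures.
From mathcomp Require Import all_boot all_order all_algebra.
From mathcomp Require Import all_classical all_reals all_analysis.

Set Implicit Arguments.
Unset Strict Implicit.
Unset Printing Implicit Defensive.

Import Order.TTheory GRing.Theory Num.Theory.
Import numFieldNormedType.Exports.

Local Open Scope classical_set_scope.
Local Open Scope ring_scope.

Section population.
Context (R : realType) (d : nat).
Implicit Types (P : probability (d.-tuple R * R)%type R)
  (kappa : R.-pker (d.-tuple R) ~> R).

(* [kappa] is a version of the conditional distribution of Y given X when
   (X, Y) ~ P:  P(X \in A, Y \in B) = E[1_A(X) kappa(X, B)]. *)
Definition is_cond_distribution P kappa : Prop :=
  forall (A : set (d.-tuple R)) (B : set R), measurable A -> measurable B ->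
    P (A `*` B) = (\int[P]_(z in A `*` setT) kappa z.1 B)%E.

Definition is_quantile (mu : set R -> \bar R) (q u : R) : Prop :=
  (q%:E <= mu [set y | (y <= u)%R])%E /\
  ((1 - q)%:E <= mu [set y | (u <= y)%R])%E.

Definition is_cond_quantile kappa (q : R) (Q : d.-tuple R -> R) : Prop :=
  measurable_fun setT Q /\ forall x, is_quantile (kappa x) q (Q x).

End population.

Section randomness.
Context (R : realType) (dO : measure_display) (Omega : measurableType dO)
  (Pr : probability Omega R).

Definition iid (dT : measure_display) (T : measurableType dT) (I : finType)
    (P : probability T R) (Z : I -> {RV Pr >-> T}) : Prop :=
  (forall i B, measurable B -> distribution Pr (Z i) B = P B) /\
  (forall (J : {set I}) (B : I -> set T), (forall i, measurable (B i)) ->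
     Pr (\bigcap_(i in [set` J]) (Z i @^-1` B i)) =
     (\prod_(i in J) Pr (Z i @^-1` B i))%E).

(* A random subset of a finite type, measurable for the discrete
   sigma-algebra on [{set I}]. *)
Definition random_subset (I : finType) (S : Omega -> {set I}) : Prop :=
  forall A : {set I}, measurable (S @^-1` [set A]).

(* The pair (S, U) of auxiliary random elements is independent of the whole
   family (Z i); rectangles form a generating pi-system on both sides. *)
Definition independent_of_data
    (dT : measure_display) (T : measurableType dT) (I : finType)
    (Z : I -> {RV Pr >-> T})
    (J : finType) (S : Omega -> {set J})
    (dU : measure_display) (TU : measurableType dU) (U : {RV Pr >-> TU})
    : Prop :=
  forall (B : I -> set T) (A : {set J}) (C : set TU),
    (forall i, measurable (B i)) -> measurable C ->
    Pr ((\bigcap_i (Z i @^-1` B i)) `&` (S @^-1` [set A] `&` U @^-1` C)) =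
    (Pr (\bigcap_i (Z i @^-1` B i)) * Pr (S @^-1` [set A] `&` U @^-1` C))%E.

End randomness.

Section split_procedure.
Context (R : realType) (d : nat).

Definition locally_nondecreasing (f : d.-tuple R -> R -> R) : Prop :=
  forall x y y', y <= y' -> f x y <= f x y'.

(* [rule I1 u z x y] is the score at (x, y) fitted with external randomness [u]
   on the points of the sample [z] whose index is in [I1]. *)
Definition fitting_rule (dU : measure_display) (TU : measurableType dU)
    (n : nat) : Type :=
  {set 'I_n} -> TU -> n.-tuple (d.-tuple R * R) -> d.-tuple R -> R -> R.

Definition is_fitting_rule (dU : measure_display) (TU : measurableType dU)
    (n : nat) (rule : fitting_rule TU n) : Prop :=
  [/\ forall I1 : {set 'I_n}, measurable_fun setT
        (fun t : (TU * n.-tuple (d.-tuple R * R)) * (d.-tuple R * R) =>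
           rule I1 t.1.1 t.1.2 t.2.1 t.2.2),
      forall (I1 : {set 'I_n}) u (z z' : n.-tuple (d.-tuple R * R)),
        (forall i, i \in I1 -> tnth z i = tnth z' i) ->
        rule I1 u z = rule I1 u z'
    & forall I1 u z, locally_nondecreasing (rule I1 u z)].

(* The p-th empirical quantile of E, i.e. its ceil (size E * p)-th smallest
   entry, counted from 1. *)
Definition emp_quantile (E : seq R) (p : R) : \bar R :=
  let k := Num.ceil ((size E)%:R * p) in
  if (k <= 0)%R then -oo%E
  else if ((size E)%:Z < k)%R then +oo%E
  else (nth 0 (sort <=%R E) (`|k|%N.-1))%:E.

Definition split_prediction_set (r s q : R)
    (dU : measure_display) (TU : measurableType dU) (n : nat)
    (rule_lo rule_hi : fitting_rule TU n)
    (I1 : {set 'I_n}) (u : TU) (z : n.-tuple (d.-tuple R * R))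
    (x : d.-tuple R) : set R :=
  let I2 := (~: I1)%SET in
  let n2 : R := #|I2|%:R in
  let f_lo := rule_lo I1 u z in
  let f_hi := rule_hi I1 u z in
  let E_lo := [seq f_lo (tnth z i).1 (tnth z i).2 | i <- enum I2] in
  let E_hi := [seq f_hi (tnth z i).1 (tnth z i).2 | i <- enum I2] in
  let Q_lo := emp_quantile E_lo (r * q * (1 + n2^-1) - n2^-1) in
  let Q_hi := emp_quantile E_hi ((1 - s * (1 - q)) * (1 + n2^-1)) in
  [set y | (Q_lo <= (f_lo x y)%:E)%E /\ ((f_hi x y)%:E <= Q_hi)%E].

End split_procedure.

(* Main.v *)
Require Import Defs.
From HB Require Import structures.
From mathcomp Require Import all_boot all_order all_algebra.
From mathcomp Require Import fingroup perm.
From mathcomp Require Import all_classical all_reals all_analysis.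
From mathcomp Require Import measurable_realfun.
From mathcomp Require Import zify ring lra.

Set Implicit Arguments.
Unset Strict Implicit.
Unset Printing Implicit Defensive.

Import Order.TTheory GRing.Theory Num.Theory.
Import numFieldNormedType.Exports.

Local Open Scope classical_set_scope.
Local Open Scope ring_scope.

(** Each of the two sides of the prediction set is treated alone.  On the
    lower side, let [Q = Quantile X] at the test point and let [B] be the
    event that [f_lo (X, Q)] falls below the empirical quantile [Q_lo].  The
    event [B] involves the training data and [X], but not the test response
    [Y]; conditionally on these, [Y <= Q] has probability at least [q].  Hence
    [q * Pr B <= Pr (B and Y <= Q)].  On the event on the right,
    [f_lo (X, Y) <= f_lo (X, Q) < Q_lo] by monotonicity, so that the test
    score has a small rank among the [n2 + 1] scores of the calibration points
    and of the test point.  The scores are fitted on the other points, so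
    these [n2 + 1] scores are exchangeable, and the small rank has probability
    at most [r * q].  Dividing by [q] gives [Pr B <= r].  The upper side is the
    same argument for the score [- f_hi] and the event [Q <= Y], of conditional
    probability at least [1 - q], and gives the bound [s].

    The split is random but independent of the data, so all this is done on an
    event [I1 = A] for a fixed [A], that is, for the finite measure [mu]
    obtained by restricting [Pr] to it, and the bounds are added over [A] at
    the end.  Under [mu] the external randomness and the data points still have
    a product law; this is hypothesis [product_law] below, and the only fact
    about the sampling that is used.  A pi-lambda argument over rectangles
    turns it into exchangeability ([exchangeable_sample]) and into the
    independence of the test point from everything that enters the fit
    ([independent_test_point]).  The conditional quantile enters through
    [kernel_lower_bound], the rank of the test score through
    [exchangeable_rank]; they are combined in [count_event_bound]. *)

(** * Measures on a product with a power *)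

Section rectangles.
Context (R : realType) (dU dT : measure_display) (TU : measurableType dU)
  (T : measurableType dT) (n : nat).

Definition rectangle (C : set TU) (B : 'I_n -> set T) : set (TU * n.-tuple T) :=
  C `*` [set t | forall i, B i (tnth t i)].

Definition rectangles : set (set (TU * n.-tuple T)) :=
  [set X | exists C B, [/\ measurable C, forall i, measurable (B i)
                         & X = rectangle C B]].

Lemma measurable_box (B : 'I_n -> set T) : (forall i, measurable (B i)) ->
  measurable [set t : n.-tuple T | forall i, B i (tnth t i)].
Proof.
move=> mB.
have -> : [set t : n.-tuple T | forall i, B i (tnth t i)] =
    \bigcap_i ((fun t : n.-tuple T => tnth t i) @^-1` B i).
  by apply/seteqP; split=> t h i; [move=> _; exact: h|exact: h].
apply: fin_bigcap_measurable => [|i _]; first exact: finite_finset.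
by rewrite -[X in measurable X]setTI; exact: measurable_tnth.
Qed.

Lemma rectangles_measurable : rectangles `<=` measurable.
Proof.
move=> _ [C [B [mC mB ->]]].
by apply: measurableX => //; exact: measurable_box.
Qed.

Lemma setI_closed_rectangles : setI_closed rectangles.
Proof.
move=> _ _ [C [B [mC mB ->]]] [C' [B' [mC' mB' ->]]].
exists (C `&` C'), (fun i => B i `&` B' i); split.
- exact: measurableI.
- by move=> i; exact: measurableI.
- apply/seteqP; split=> [[u t]/= [[? h] [? h']]|[u t]/= [[? ?] h]].
    by split=> // i; split.
  by split; split=> // i; have [] := h i.
Qed.

(** The sigma-algebra of tuples is generated by one coordinate at a time, so it
    suffices that every coordinate is measurable for the sigma-algebra
    generated by the rectangles. *)
Lemma measurable_rectangles : measurable = <<s rectangles >>.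
Proof.
apply/seteqP; split; last first.
  apply: smallest_sub; first exact: sigma_algebra_measurable.
  exact: rectangles_measurable.
apply: smallest_sub; first exact: smallest_sigma_algebra.
rewrite subUset; split.
  move=> _ [C mC <-]; apply: sub_sigma_algebra; exists C, (fun=> setT).
  by split=> //; apply/seteqP; split=> -[u t] /= [].
pose GT := g_sigma_algebraType rectangles.
suff h : measurable_fun [set: GT] (snd : GT -> n.-tuple T).
  by move=> _ [B mB <-]; exact: h.
apply/measurable_fun_tnthP => i _ B mB; apply: sub_sigma_algebra.
exists setT, (fun j => if j == i then B else setT); split=> //.
  by move=> j; case: ifP.
apply/seteqP; split=> [[u t]/= [_ h]|[u t]/= [_ h]]; split=> //.
  by move=> j; case: eqP => [->|].
by have := h i; rewrite eqxx.
Qed.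

(** Rectangles are a pi-system, which makes the law of a sample determined by
    the product rule for events that constrain each point separately. *)
Lemma finite_measure_unique_rectangles
    (m1 m2 : {measure set (TU * n.-tuple T) -> \bar R}) :
  (m1 setT < +oo)%E ->
  (forall C B, measurable C -> (forall i, measurable (B i)) ->
     m1 (rectangle C B) = m2 (rectangle C B)) ->
  forall X, measurable X -> m1 X = m2 X.
Proof.
move=> m1oo m12 X mX.
apply: (measure_unique rectangles (fun=> setT)) => //.
- exact: measurable_rectangles.
- exact: setI_closed_rectangles.
- move=> _; exists setT, (fun=> setT); split=> //.
  by apply/seteqP; split=> -[u t].
- by rewrite bigcup_const.
- by move=> _ [C [B [mC mB ->]]]; exact: m12.
Qed.

End rectangles.

(** * Disintegration along a probability kernel *)

Section mixture.
Context (R : realType) (d1 d2 : measure_display) (T1 : measurableType d1)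
  (T2 : measurableType d2) (P : probability (T1 * T2)%type R)
  (kappa : R.-pker T1 ~> T2).
Local Open Scope ereal_scope.

(** The integral runs over the joint law [P] and reads off the first
    coordinate: this is the marginal law of [X] composed with [kappa], without
    a name for the marginal. *)
Definition mixture (X : set (T1 * T2)) : \bar R :=
  \int[P]_z kappa z.1 (xsection X z.1).

Lemma measurable_kernel_xsection (X : set (T1 * T2)) : measurable X ->
  measurable_fun setT (fun z : T1 * T2 => kappa z.1 (xsection X z.1)).
Proof.
move=> mX.
apply: (@measurableT_comp _ _ _ _ _ _ (fun x => kappa x (xsection X x))) => //.
by apply: measurable_fun_xsection_finite_kernel; rewrite inE.
Qed.

Let mixture0 : mixture set0 = 0.
Proof. by rewrite [LHS]integral0_eq// => x _; rewrite xsection0. Qed.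

Let mixture_ge0 X : 0 <= mixture X.
Proof. by apply: integral_ge0 => // *. Qed.

Let mixture_sigma_additive : semi_sigma_additive mixture.
Proof.
move=> F mF tF mUF.
rewrite [X in _ --> X](_ : _ = \sum_(n <oo) mixture (F n)).
  by apply/cvg_closeP; split; [exact: is_cvg_nneseries|rewrite closeE].
rewrite /mixture -integral_nneseries//; last first.
  by move=> n; exact: measurable_kernel_xsection.
apply: eq_integral => x _; apply/esym/cvg_lim => //=; rewrite xsection_bigcup.
apply: (measure_sigma_additive _ (trivIset_xsection tF)) => ?.
exact: measurable_xsection.
Qed.

HB.instance Definition _ := isMeasure.Build _ _ _ mixture
  mixture0 mixture_ge0 mixture_sigma_additive.

Hypothesis kappaP : forall A B, measurable A -> measurable B ->
  P (A `*` B) = \int[P]_(z in A `*` setT) kappa z.1 B.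

(** The rectangle rule extends to all measurable sets; events such as
    [Y <= Quantile X] are not rectangles. *)
Lemma disintegration X : measurable X -> P X = mixture X.
Proof.
move=> mX; apply: (measure_unique
  [set A `*` B | A in measurable & B in measurable] (fun=> setT)) => //.
- exact: measurable_prod_measurableType.
- move=> _ _ [A1 mA1 [B1 mB1 <-]] [A2 mA2 [B2 mB2 <-]].
  exists (A1 `&` A2); first exact: measurableI.
  by exists (B1 `&` B2); [exact: measurableI|rewrite setXI].
- by move=> _; exists setT => //; exists setT => //; rewrite setXTT.
- by rewrite bigcup_const.
- move=> _ [A mA [B mB <-]]; apply: etrans (kappaP mA mB) _.
  rewrite /= /mixture integral_mkcond.
  apply: eq_integral => -[x y] _; rewrite patchE /=.
  case: ifPn => [/[!inE] -[/= Ax _]|].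
    by rewrite in_xsectionX ?inE.
  move=> /negP; rewrite inE/= => nAx.
  rewrite notin_xsectionX ?measure0//.
  by apply/negP; rewrite inE => Ax; exact: nAx.
- by move=> _; apply: le_lt_trans (ltry 1); exact: probability_le1.
Qed.

(** A conditional probability bounded below uniformly in [x] bounds the joint
    probability below on every event about [X] alone.  With
    [H] one of the events [Y <= Quantile X] and [Quantile X <= Y], this is all
    that the proof takes from the conditional quantile. *)
Lemma kernel_lower_bound (p : R) (H : set (T1 * T2)) (G : set T1) :
  (0 <= p)%R -> measurable H -> measurable G ->
  (forall x, p%:E <= kappa x (xsection H x)) ->
  p%:E * P (G `*` setT) <= P (G `*` setT `&` H).
Proof.
move=> p0 mH mG pH.
have mGT : measurable (G `*` [set: T2]) by exact: measurableX.
have mGH : measurable (G `*` [set: T2] `&` H) by exact: measurableI.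
have -> : P (G `*` setT) = \int[P]_z (\1_(G `*` setT) z)%:E.
  by rewrite integral_indic// setIT.
rewrite disintegration// /mixture.
have mI : measurable_fun setT (fun z => (\1_(G `*` [set: T2]) z)%:E : \bar R).
  exact/measurable_EFinP.
rewrite -ge0_integralZl//.
apply: ge0_le_integral => //.
- by move=> z _; rewrite mule_ge0// lee_fin.
- exact: measurable_funeM.
- exact: measurable_kernel_xsection.
- move=> [x y] _ /=; rewrite indicE.
  have [/[!inE] -[/= Gx _]|_] := boolP ((x, y) \in _); last by rewrite mule0.
  rewrite mule1 (le_trans (pH x))// le_measure ?inE//;
    try exact: measurable_xsection.
  by move=> b /xsectionP Hb; apply/xsectionP.
Qed.

End mixture.

(** * Ranks of exchangeable scores *)

Section ranks.
Context (R : realType) (I : finType).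

(** The largest score among the indices of small rank dominates all of them, so
    its own rank, which is small, bounds their number.  Ties are harmless since
    ranks count the scores that are at most the given one. *)
Lemma card_small_ranks (J : {set I}) (e : I -> R) (x : R) : 0 <= x ->
  #|[set j in J | #|[set i in J | e i <= e j]|%:R <= x]|%:R <= x.
Proof.
move=> x0; set K := [set j in J | _]%SET.
have [->|/set0Pn[j0 Kj0]] := eqVneq K finset.set0; first by rewrite cards0.
have [j Kj jmax] := @arg_maxP _ _ _ j0 (fun j => j \in K) e Kj0.
move: (Kj); rewrite [_ \in _]inE => /andP[_ jk]; apply: le_trans jk.
rewrite ler_nat; apply: subset_leq_card.
apply/fintype.subsetP => i Ki; rewrite inE; apply/andP; split; last exact: jmax.
by move: Ki; rewrite inE => /andP[].
Qed.

Context (dO : measure_display) (Omega : measurableType dO).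

(** A random subset of a finite type takes finitely many values, so every
    property of it is an event. *)
Lemma measurable_random_set (b : I -> Omega -> bool) (F : {set I} -> bool) :
  (forall i, measurable [set w | b i w]) ->
  measurable [set w | F [set i | b i w]%SET].
Proof.
move=> mb.
have -> : [set w | F [set i | b i w]%SET] =
    \bigcup_(K in [set K | F K]) \bigcap_i [set w | (i \in K) = b i w].
  apply/seteqP; split => w /=.
    by move=> Fw; exists [set i | b i w]%SET => // i _ /=; rewrite inE.
  by move=> [K FK h]; congr (is_true (F _)): FK; apply/setP => i;
    rewrite inE; exact: h.
apply: fin_bigcup_measurable => [|K _]; first exact: finite_finset.
apply: fin_bigcap_measurable => [|i _]; first exact: finite_finset.
have [iK|iK] := boolP (i \in K).
  by congr (measurable _): (mb i); apply/seteqP; split => w /=; case: (b i w).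
congr (measurable _): (measurableC (mb i)).
by apply/seteqP; split => w /=; case: (b i w).
Qed.

Lemma measurable_card_le (J : {set I}) (e : I -> Omega -> R) (c : Omega -> R)
    (F : nat -> bool) :
  (forall i, measurable_fun setT (e i)) -> measurable_fun setT c ->
  measurable [set w | F #|[set i in J | e i w <= c w]%SET|].
Proof.
move=> me mc; have := @measurable_random_set
  (fun i w => (i \in J) && (e i w <= c w)) (fun K => F #|K|).
apply => i; case: (i \in J) => /=; last first.
  by rewrite [X in measurable X](_ : _ = set0)//; apply/seteqP; split.
by rewrite -[X in measurable X]setTI; exact: measurable_fun_le.
Qed.

(** The expected number of indices of rank at most [x] is at most [x], and
    exchangeability shares this expectation equally between the indices. *)
Lemma exchangeable_rank (mu : {measure set Omega -> \bar R}) (J : {set I})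
    (e : I -> Omega -> R) (j0 : I) (x : R) :
  0 <= x ->
  (forall i, measurable_fun setT (e i)) ->
  (forall j, j \in J ->
     mu [set w | #|[set i in J | e i w <= e j w]|%:R <= x] =
     mu [set w | #|[set i in J | e i w <= e j0 w]|%:R <= x]) ->
  (#|J|%:R%:E * mu [set w | #|[set i in J | e i w <= e j0 w]|%:R <= x]%R <=
   x%:E * mu setT)%E.
Proof.
move=> x0 me exch.
pose G j := [set w | #|[set i in J | e i w <= e j w]|%:R <= x].
have mG j : measurable (G j).
  exact: (measurable_card_le J (fun k => k%:R <= x)).
have -> : (#|J|%:R%:E * mu (G j0) = \sum_(j in J) mu (G j))%E.
  rewrite (eq_bigr (fun=> mu (G j0))); last by move=> j /exch.
  by rewrite sumr_const muleC mule_natr.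
rewrite (eq_bigr (fun j => \int[mu]_w (\1_(G j) w)%:E)%E); last first.
  by move=> j _; rewrite integral_indic// setIT.
rewrite -big_enum -ge0_integral_sum//; last first.
  by move=> j; exact/measurable_EFinP.
rewrite -integral_cst//; apply: ge0_le_integral => //.
- by move=> w _; apply: sume_ge0 => j _; rewrite lee_fin.
- by apply: emeasurable_sum => j; exact/measurable_EFinP.
- move=> w _; rewrite big_enum sumEFin lee_fin.
  rewrite (eq_bigr (fun j => ((w \in G j) : nat)%:R))//.
  rewrite -natr_sum -big_mkcondr sum1_card.
  apply: le_trans (card_small_ranks J (e^~ w) x0); rewrite ler_nat.
  apply: subset_leq_card; apply/fintype.subsetP => j.
  rewrite !inE => /andP[-> /=].
  by rewrite inE.
Qed.

End ranks.

(** * The law of the sample *)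

Section image_law.
Context (R : realType) (d1 d2 : measure_display) (T1 : measurableType d1)
  (T2 : measurableType d2) (mu : {finite_measure set T1 -> \bar R}).
Local Open Scope ereal_scope.

(** The measurability proof is an argument so that the image measure carries a
    canonical structure of finite measure. *)
Definition image_law (f : T1 -> T2) (mf : measurable_fun setT f)
  (X : set T2) : \bar R := mu (f @^-1` X).

Context (f : T1 -> T2) (mf : measurable_fun setT f).

Let preimage_measurable X : measurable X -> measurable (f @^-1` X).
Proof. by move=> mX; rewrite -[X in measurable X]setTI; exact: mf. Qed.

Let law0 : image_law mf set0 = 0.
Proof. by rewrite /image_law preimage_set0 measure0. Qed.

Let law_ge0 X : 0 <= image_law mf X.
Proof. exact: measure_ge0. Qed.

Let law_sigma_additive : semi_sigma_additive (image_law mf).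
Proof.
move=> F mF tF mUF; rewrite /image_law preimage_bigcup.
apply: measure_semi_sigma_additive.
- by move=> n; exact: preimage_measurable.
- apply/trivIsetP => /= i j _ _ ij; rewrite -preimage_setI.
  by move/trivIsetP : tF => /(_ _ _ _ _ ij) ->//; rewrite preimage_set0.
- by rewrite -preimage_bigcup; exact: preimage_measurable.
Qed.

HB.instance Definition _ := isMeasure.Build _ _ _ (image_law mf)
  law0 law_ge0 law_sigma_additive.

Let law_finite : fin_num_fun (image_law mf).
Proof.
by move=> X mX; rewrite /image_law fin_num_measure//; exact: preimage_measurable.
Qed.

HB.instance Definition _ :=
  @Measure_isFinite.Build _ _ _ (image_law mf) law_finite.

End image_law.

Section sample.
Context (R : realType) (dO dT dU : measure_display) (Omega : measurableType dO)
  (T : measurableType dT) (TU : measurableType dU) (n : nat)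
  (mu : {finite_measure set Omega -> \bar R}) (P : probability T R)
  (Z : 'I_n.+1 -> {mfun Omega >-> T}) (U : {mfun Omega >-> TU}).
Local Open Scope ereal_scope.

Definition training_sample (w : Omega) : n.-tuple T :=
  [tuple Z (widen_ord (leqnSn n) i) w | i < n].

Definition permuted_sample (sigma : {perm 'I_n.+1}) (w : Omega)
  : TU * n.+1.-tuple T := (U w, [tuple Z (sigma i) w | i < n.+1]).

Lemma measurable_mktuple m (f : 'I_m -> Omega -> T) :
  (forall i, measurable_fun setT (f i)) ->
  measurable_fun setT (fun w => [tuple f i w | i < m]).
Proof.
move=> mf; apply/measurable_fun_tnthP => i.
rewrite (_ : _ \o _ = f i)//; apply/funext => w /=; exact: tnth_mktuple.
Qed.

Lemma measurable_training_sample : measurable_fun setT training_sample.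
Proof. exact: measurable_mktuple. Qed.

Lemma measurable_permuted_sample sigma :
  measurable_fun setT (permuted_sample sigma).
Proof.
by apply/measurable_fun_pairP; split=> //=; exact: measurable_mktuple.
Qed.

(** The mass of [mu] is carried by the external randomness [U], because [mu]
    will be a probability restricted to an event that is independent of [Z]. *)
Hypothesis product_law : forall C B, measurable C ->
  (forall i, measurable (B i)) ->
  mu (U @^-1` C `&` \bigcap_i (Z i @^-1` B i)) =
  mu (U @^-1` C) * \prod_i P (B i).

(** On rectangles a permutation only reorders the factors of the product. *)
Lemma exchangeable_sample sigma X : measurable X ->
  mu (permuted_sample sigma @^-1` X) = mu (permuted_sample 1 @^-1` X).
Proof.
move=> mX.
have law s C B : measurable C -> (forall i, measurable (B i)) ->
    mu (permuted_sample s @^-1` rectangle C B) =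
    mu (U @^-1` C) * \prod_i P (B i).
  move=> mC mB; rewrite (reindex_inj (@perm_inj _ s^-1%g)) /= -product_law//.
  congr (mu _); apply/seteqP; split=> w /= [Cw Bw]; split=> // i.
    by have := Bw (s^-1%g i); rewrite tnth_mktuple permKV.
  by have := Bw (s i) Logic.I; rewrite tnth_mktuple /= permK.
pose m s := image_law mu (measurable_permuted_sample s).
apply: (@finite_measure_unique_rectangles _ _ _ _ _ _ (m sigma) (m 1%g)) => //.
  by rewrite ltey_eq fin_num_measure.
move=> C B mC mB; exact: etrans (law _ _ _ mC mB) (esym (law _ _ _ mC mB)).
Qed.

Definition fitting_data (w : Omega) : TU * n.-tuple T :=
  (U w, training_sample w).

Lemma measurable_fitting_data : measurable_fun setT fitting_data.
Proof.
by apply: measurable_fun_pair => //; exact: measurable_training_sample.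
Qed.

(** Sections of a product measure replace conditioning on the fitting data. *)
Lemma independent_test_point X : measurable X ->
  mu [set w | X (fitting_data w, Z ord_max w)] =
  (image_law mu measurable_fitting_data \x P) X.
Proof.
move=> mX; apply/esym.
have mf : measurable_fun setT (fun w => (fitting_data w, Z ord_max w)).
  by apply: measurable_fun_pair => //; exact: measurable_fitting_data.
apply: (@product_measure_unique _ _ _ _ _ _ P (image_law mu mf)) => //.
move=> A B mA mB.
have mZB : measurable (Z ord_max @^-1` B).
  by rewrite -[X in measurable X]setTI; exact: measurable_funPT.
pose r := NngNum (fine_ge0 (measure_ge0 P B)).
have rE : r%:num%:E = P B by rewrite /= fineK// fin_num_measure.
pose m1 := image_law mu measurable_fitting_data.
pose m2 := image_law (mrestr mu mZB) measurable_fitting_data.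
(* for fixed B, compare two measures in A, one of them scaled by P B *)
change (m2 A = m1 A * P B); rewrite muleC -rE; change (m2 A = mscale r m1 A).
apply: (@finite_measure_unique_rectangles _ _ _ _ _ _ m2 (mscale r m1)) => //.
  by rewrite ltey_eq fin_num_measure.
move=> C D mC mD.
(* the box for all n + 1 points: D for the training points, E for the test *)
pose D' E j := oapp D E (unlift ord_max j).
have mD' E j : measurable E -> measurable (D' E j).
  by move=> mE; rewrite /D'; case: unlift.
have widenE i : widen_ord (leqnSn n) i = lift ord_max i.
  by apply/val_inj; rewrite /= /bump leqNgt ltn_ord.
have D'P E w : (\bigcap_i (Z i @^-1` D' E i)) w <->
    (forall i, D i (tnth (training_sample w) i)) /\ E (Z ord_max w).
  split=> [h|[h1 h2] i _]; last first.
    rewrite /D' /=; case: unliftP => [j ->|->] //=.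
    by have := h1 j; rewrite tnth_mktuple widenE.
  split=> [i|]; last by have := h ord_max Logic.I; rewrite /D' /= unlift_none.
  by have := h (lift ord_max i) Logic.I; rewrite /D' /= liftK tnth_mktuple widenE.
have prodE E : \prod_i P (D' E i) = (\prod_i P (D i)) * P E.
  rewrite big_ord_recr /= /D' unlift_none /=; congr (_ * _).
  by apply: eq_bigr => i _; rewrite widenE liftK.
have lawD E : measurable E ->
    mu (fitting_data @^-1` rectangle C D `&` Z ord_max @^-1` E) =
    mu (U @^-1` C) * (\prod_i P (D i)) * P E.
  move=> mE; rewrite -muleA -prodE -product_law//; last by move=> i; exact: mD'.
  congr (mu _); apply/seteqP; split=> w.
    by move=> [[Cw Dw] Ew]; split=> //; apply/D'P.
  by move=> [Cw /D'P[Dw Ew]].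
change (m2 (rectangle C D) = r%:num%:E * m1 (rectangle C D)); rewrite rE.
apply: etrans (lawD B mB) _.
rewrite muleC; congr (_ * _).
apply: etrans (esym (_ : _ * P setT = _)) _.
  by rewrite probability_setT mule1.
by apply: etrans (esym (lawD setT _)) _; rewrite // preimage_setT setIT.
Qed.

End sample.

(** * A bound for one side of the prediction set *)

Section one_sided.
Context (R : realType) (dO dU d1 d2 : measure_display)
  (Omega : measurableType dO) (TU : measurableType dU)
  (T1 : measurableType d1) (T2 : measurableType d2) (n : nat)
  (mu : {finite_measure set Omega -> \bar R})
  (P : probability (T1 * T2)%type R) (kappa : R.-pker T1 ~> T2)
  (Z : 'I_n.+1 -> {mfun Omega >-> (T1 * T2)%type}) (U : {mfun Omega >-> TU}).
Local Notation T := (T1 * T2)%type.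
Local Notation train := (training_sample Z).

Hypothesis kappaP : forall A B, measurable A -> measurable B ->
  P (A `*` B) = (\int[P]_(z in A `*` setT) kappa z.1 B)%E.
Hypothesis product_law : forall C B, measurable C ->
  (forall i, measurable (B i)) ->
  mu (U @^-1` C `&` \bigcap_i (Z i @^-1` B i)) =
  (mu (U @^-1` C) * \prod_i P (B i))%E.

(** An event [D] about the fitting data and the test covariate leaves the test
    response with its conditional law, which gives [H] probability at least
    [p]. *)
Lemma test_point_lower_bound (p : R) (H : set T)
    (D : set ((TU * n.-tuple T) * T1)) :
  0 <= p -> measurable H -> measurable D ->
  (forall x, (p%:E <= kappa x (xsection H x))%E) ->
  (p%:E * mu [set w | D (fitting_data Z U w, (Z ord_max w).1)] <=
   mu [set w | D (fitting_data Z U w, (Z ord_max w).1) /\ H (Z ord_max w)])%E.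
Proof.
move=> p0 mH mD pH.
pose DT : set ((TU * n.-tuple T) * T) := [set a | D (a.1, a.2.1)].
have mDT : measurable DT.
  rewrite -[X in measurable X]setTI.
  have mf : measurable_fun setT
      (fun a : (TU * n.-tuple T) * T => (a.1, a.2.1)).
    by apply: measurable_fun_pair => //; exact: measurableT_comp.
  exact: mf.
have mHT : measurable ([set: TU * n.-tuple T] `*` H) by exact: measurableX.
have mDH : measurable (DT `&` (setT `*` H)) by exact: measurableI.
rewrite (independent_test_point product_law mDT).
have -> : mu [set w | D (fitting_data Z U w, (Z ord_max w).1) /\
    H (Z ord_max w)] = (image_law mu (measurable_fitting_data Z U) \x P)%E
      (DT `&` (setT `*` H)).
  rewrite -(independent_test_point product_law mDH); congr (mu _).
  by apply/seteqP; split=> w /= [? ?]; do ?split=> //; tauto.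
rewrite /product_measure1 -ge0_integralZl//; last exact: measurable_fun_xsection.
apply: ge0_le_integral => //.
- by move=> a _; rewrite mule_ge0.
- by apply: measurable_funeM; exact: measurable_fun_xsection.
- exact: measurable_fun_xsection.
- move=> a _ /=.
  have -> : xsection DT a = xsection D a `*` setT.
    by rewrite !xsectionE; apply/seteqP; split=> -[x y] //= [].
  have -> : xsection (DT `&` (setT `*` H)) a = xsection D a `*` setT `&` H.
    rewrite !xsectionE; apply/seteqP; split=> -[x y] /=.
      by move=> [? []].
    by move=> [[]].
  by apply: (kernel_lower_bound kappaP) => //; exact: measurable_xsection.
Qed.

Context (A : {set 'I_n}) (h : TU -> n.-tuple T -> T -> R).
Hypothesis measurable_score : measurable_fun setT
  (fun a : (TU * n.-tuple T) * T => h a.1.1 a.1.2 a.2).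
Hypothesis score_local : forall u (z z' : n.-tuple T),
  (forall i, i \in A -> tnth z i = tnth z' i) -> h u z = h u z'.

Let score w := h (U w) (train w).
(* the calibration points, that is, those not used for the fit, and the test
   point *)
Let J : {set 'I_n.+1} := (ord_max |: [set lift ord_max i | i in ~: A])%SET.

Let widenE i : widen_ord (leqnSn n) i = lift ord_max i.
Proof. by apply/val_inj; rewrite /= /bump leqNgt ltn_ord. Qed.

Let card_J : #|J| = #|~: A|.+1.
Proof.
rewrite cardsU1 card_imset; last exact: lift_inj.
case: imsetP => [[i _ /eqP]|//]; by rewrite (negbTE (neq_lift _ _)).
Qed.

Let lift_J i : (lift ord_max i \in J) = (i \notin A).
Proof.
rewrite !inE eq_sym (negbTE (neq_lift _ _)) /= mem_imset ?inE//.
exact: lift_inj.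
Qed.

Lemma measurable_score_at (f : Omega -> T) : measurable_fun setT f ->
  measurable_fun setT (fun w => score w (f w)).
Proof.
move=> mf; have mg : measurable_fun setT (fun w => (fitting_data Z U w, f w)).
  by apply: measurable_fun_pair => //; exact: measurable_fitting_data.
exact: (measurableT_comp measurable_score mg).
Qed.

(** Exchanging the test point with a calibration point permutes the indices of
    [J] and leaves the fitted score unchanged, since it depends only on the
    points of [A]. *)
Lemma score_rank_bound (x : R) : 0 <= x ->
  ((#|~: A|.+1)%:R%:E *
     mu [set w | #|[set i in J | score w (Z i w) <= score w (Z ord_max w)]|%:R
                 <= x]%R <= x%:E * mu setT)%E.
Proof.
move=> x0; rewrite -card_J.
apply: (@exchangeable_rank _ _ _ _ mu J (fun i w => score w (Z i w))) => //.
  by move=> i; exact: measurable_score_at.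
pose tr (t : n.+1.-tuple T) : n.-tuple T :=
  [tuple tnth t (lift ord_max i) | i < n].
pose s (a : TU * n.+1.-tuple T) i := h a.1 (tr a.2) (tnth a.2 i).
have ms i : measurable_fun setT (s ^~ i).
  have mtnth k : measurable_fun setT
      (fun a : TU * n.+1.-tuple T => tnth a.2 k).
    exact: (measurableT_comp (measurable_tnth k) measurable_snd).
  have mf : measurable_fun setT
      (fun a : TU * n.+1.-tuple T => ((a.1, tr a.2), tnth a.2 i)).
    apply: measurable_fun_pair => //; apply: measurable_fun_pair => //.
    by apply: measurable_mktuple => k.
  exact: (measurableT_comp measurable_score mf).
(* the small rank event, read on the sample instead of on Omega *)
pose X := [set a | #|[set i in J | s a i <= s a ord_max]|%:R <= x].
have mX : measurable X.
  exact: (measurable_card_le J (fun k => k%:R <= x) ms (ms ord_max)).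
have XE (sigma : {perm 'I_n.+1}) :
    (forall i, i \in A -> sigma (lift ord_max i) = lift ord_max i) ->
    (forall i, (sigma i \in J) = (i \in J)) ->
    permuted_sample Z U sigma @^-1` X =
    [set w | #|[set i in J | score w (Z i w) <= score w (Z (sigma ord_max) w)]|%:R
             <= x].
  move=> sA sJ; apply/funext => w; congr (is_true (_%:R <= x)).
  rewrite -[RHS](card_preimset _ (@perm_inj _ sigma)).
  congr #|pred_of_set _|; apply/setP => i.
  rewrite [LHS]finset.in_set [RHS]finset.in_set [RHS]finset.in_set sJ.
  congr (_ && _).
  rewrite /s /= !tnth_mktuple /score.
  suff -> : h (U w) (tr [tuple Z (sigma i) w | i < n.+1]) = h (U w) (train w) by [].
  by apply: score_local => k kA; rewrite !tnth_mktuple sA// widenE.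
move=> j jJ.
have := exchangeable_sample product_law (tperm j ord_max) mX.
rewrite !XE ?tpermR ?perm1//; try by move=> *; rewrite perm1.
- move=> i iA; rewrite tpermD ?neq_lift//.
  by apply: contraTneq jJ => ->; rewrite lift_J iA.
- have maxJ : ord_max \in J by rewrite !inE eqxx.
  by move=> i; case: tpermP => [->|->|//]; rewrite jJ maxJ.
Qed.

Context (v : T1 -> T2) (H : set T) (p : R).
Hypothesis mv : measurable_fun setT v.
Hypothesis mH : measurable H.
Hypothesis p_gt0 : 0 < p.
Hypothesis kernel_H : forall x, (p%:E <= kappa x (xsection H x))%E.
Hypothesis score_H : forall u z x y, H (x, y) -> h u z (x, y) <= h u z (x, v x).

(** Here [v X] stands for the conditional quantile at the test point.  A
    predicate on counts, in place of a threshold, covers both the strict and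
    the weak inequality that the two empirical quantiles lead to. *)
Definition count_event (F : nat -> bool) : set Omega := [set w |
  F #|[set i in ~: A | score w (tnth (train w) i) <=
         score w ((Z ord_max w).1, v (Z ord_max w).1)]|].

Lemma measurable_count_event F : measurable (count_event F).
Proof.
apply: measurable_card_le => [i|].
  apply: measurable_score_at.
  exact: (measurableT_comp (measurable_tnth i) (measurable_training_sample Z)).
have mX : measurable_fun setT (fun w => (Z ord_max w).1).
  exact: (measurableT_comp measurable_fst).
apply: measurable_score_at; apply: measurable_fun_pair => //.
exact: measurableT_comp.
Qed.

(** On [H] the test score is at most the score at [(X, v X)], so a small count
    there forces a small rank of the test score.  Since [H] has conditional
    probability at least [p], the factor [p] in the threshold cancels. *)
Lemma count_event_bound (r : R) (F : nat -> bool) : 0 <= r ->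
  (forall k, F k -> k.+1%:R <= r * p * (#|~: A|.+1)%:R) ->
  (mu (count_event F) <= r%:E * mu setT)%E.
Proof.
move=> r0 Fr; pose x := r * p * (#|~: A|.+1)%:R.
have x0 : 0 <= x by rewrite !mulr_ge0// ltW.
pose g (a : (TU * n.-tuple T) * T1) z := h a.1.1 a.1.2 z.
pose D := [set a | F #|[set i in ~: A | g a (tnth a.1.2 i) <=
  g a (a.2, v a.2)]|].
have mD : measurable D.
  have m1 i : measurable_fun setT
      (fun a : (TU * n.-tuple T) * T1 => (a.1, tnth a.1.2 i)).
    apply: measurable_fun_pair => //.
    apply: (measurableT_comp (measurable_tnth i)).
    exact: (measurableT_comp measurable_snd measurable_fst).
  have m2 : measurable_fun setT
      (fun a : (TU * n.-tuple T) * T1 => (a.1, (a.2, v a.2))).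
    apply: measurable_fun_pair => //; apply: measurable_fun_pair => //.
    exact: measurableT_comp.
  apply: measurable_card_le => [i|].
    exact: (measurableT_comp measurable_score (m1 i)).
  exact: (measurableT_comp measurable_score m2).
have := test_point_lower_bound (ltW p_gt0) mH mD kernel_H.
have -> : [set w | D (fitting_data Z U w, (Z ord_max w).1)] = count_event F by [].
move=> lower.
have := score_rank_bound x0; set W := [set w | _] => upper.
have missW : (p%:E * mu (count_event F) <= mu W)%E.
  apply: le_trans lower _; apply: le_measure; rewrite ?inE.
  - rewrite (_ : [set w | _ /\ _] = count_event F `&` Z ord_max @^-1` H)//.
    apply: measurableI; first exact: measurable_count_event.
    by rewrite -[X in measurable X]setTI; exact: measurable_funPT.
  - by apply: (measurable_card_le J (fun k => k%:R <= x)) => [i|];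
      exact: measurable_score_at.
  - move=> w [missw Hw]; apply: le_trans (Fr _ missw); rewrite ler_nat.
    set K := [set i in ~: A | _]%SET.
    apply: (@leq_trans #|ord_max |: [set lift ord_max i | i in K]|%SET).
      apply: subset_leq_card; apply/fintype.subsetP => i.
      rewrite finset.in_set => /andP[]; rewrite /J in_setU1.
      case: eqP => [->|_] /=; first by rewrite in_setU1 eqxx.
      case/imsetP => j jA -> ej; rewrite in_setU1; apply/orP; right.
      apply: imset_f; rewrite finset.in_set jA /= tnth_mktuple widenE.
      apply: le_trans ej _; rewrite [X in score w X]surjective_pairing.
      by apply: score_H; rewrite -surjective_pairing.
    (* the test point itself accounts for the successor *)
    by rewrite cardsU1; exact: (@leq_add _ _ 1 _ (leq_b1 _) (leq_imset_card _ _)).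
have mp_gt0 : 0 < (#|~: A|.+1)%:R * p by rewrite mulr_gt0.
rewrite -(@lee_pmul2l _ ((#|~: A|.+1)%:R * p)%:E) ?lte_fin//.
apply: (@le_trans _ _ ((#|~: A|.+1)%:R%:E * mu W)%E).
  by rewrite EFinM -muleA; exact: lee_wpmul2l missW.
by apply: le_trans upper _; rewrite muleA -EFinM /x mulrC [r * p]mulrC mulrA.
Qed.

End one_sided.

(** * Empirical quantiles as counts *)

Section empirical_quantile.
Context (R : realType) (E : seq R) (p v : R).

Let sorted_sort : sorted <=%R (sort <=%R E).
Proof. exact: sort_le_sorted. Qed.

(** The comparisons with the [k]-th smallest entry are counts compared with [k],
    and as counts are integers the ceiling in [k] disappears.  The infinite
    values make both equivalences hold for every [p]. *)
Lemma emp_quantile_le :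
  (emp_quantile E p <= v%:E)%E =
  ((size E)%:R * p <= (count (fun e => e <= v) E)%:R).
Proof.
rewrite -[(count _ _)%:R]/((count _ _)%:Z%:~R) -ceil_le_int /emp_quantile.
set c := count _ E; set k := Num.ceil _.
have cE : (c <= size E)%N := count_size _ _.
case: ifP => k0; first by rewrite leNye; apply/esym; lia.
case: ifP => kE; first by rewrite leye_eq; apply/esym/negbTE; rewrite -ltNge; lia.
rewrite lee_fin.
have cs : c = count (<= v) (sort <=%R E) by apply/esym/seq.permP; rewrite perm_sort.
have [vk|vk] := leqP c `|k|.-1.
  rewrite leNgt nth_count_gt//; last first.
    by rewrite -cs size_sort -[size _]/(size E); lia.
  by apply/esym/negbTE; rewrite -ltNge; lia.
by rewrite nth_count_le//; [apply/esym; lia|rewrite -cs].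
Qed.

Lemma le_emp_quantile :
  (v%:E <= emp_quantile E p)%E =
  ((count (fun e => e < v) E)%:R < (size E)%:R * p).
Proof.
rewrite -[(count _ _)%:R]/((count _ _)%:Z%:~R) -ceil_gt_int /emp_quantile.
set c := count _ E; set k := Num.ceil _.
have cE : (c <= size E)%N := count_size _ _.
case: ifP => k0; first by rewrite leeNy_eq; apply/esym/negbTE; rewrite -leNgt; lia.
case: ifP => kE; first by rewrite leey; apply/esym; lia.
rewrite lee_fin.
have cs : c = count (< v) (sort <=%R E) by apply/esym/seq.permP; rewrite perm_sort.
have [vk|vk] := leqP c `|k|.-1.
  rewrite nth_count_ge//; last first.
    by rewrite -cs size_sort -[size _]/(size E); lia.
  by apply/esym; lia.
rewrite leNgt nth_count_lt//; last by rewrite -cs.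
by apply/esym/negbTE; rewrite -leNgt; lia.
Qed.

End empirical_quantile.

(** * Conditioning on the split *)

Section fibers.
Context (R : realType) (dO : measure_display) (Omega : measurableType dO)
  (Pr : probability Omega R) (I : finType) (S : Omega -> I).
Hypothesis mS : forall A, measurable (S @^-1` [set A]).
Local Open Scope ereal_scope.

Lemma probability_fibers (G : set Omega) :
  (forall A, measurable (G `&` S @^-1` [set A])) ->
  Pr G = \sum_A Pr (G `&` S @^-1` [set A]).
Proof.
move=> mG; rewrite fsbig_seq ?index_enum_uniq//.
rewrite -measure_fin_bigcup//; last first.
  by apply/trivIsetP => A B _ _ AB; apply/seteqP; split=> // w [[_ /= SA] [_ SB]];
    move: AB; rewrite -SA -SB eqxx.
congr (Pr _); apply/seteqP; split=> [w Gw|w [A _ []]//].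
by exists (S w) => //=; rewrite mem_index_enum.
Qed.

Lemma probability_ge_fibers (c : R) (G : set Omega) : (0 <= c)%R ->
  (forall A, measurable (G `&` S @^-1` [set A])) ->
  (forall A, c%:E * Pr (S @^-1` [set A]) <= Pr (G `&` S @^-1` [set A])) ->
  c%:E <= Pr G.
Proof.
move=> c0 mG cG; rewrite (probability_fibers mG).
rewrite -[c%:E]mule1 -(probability_setT Pr) (@probability_fibers setT); last first.
  by move=> A; rewrite setTI.
rewrite ge0_sume_distrr//.
by apply: lee_sum => A _; rewrite setTI.
Qed.

End fibers.

Lemma card_set_count (I : finType) (B : {set I}) (a : pred I) :
  #|[set i in B | a i]| = count a (enum B).
Proof.
rewrite cardE -size_filter -filter_predI; congr size; apply: eq_filter => i.
by rewrite /= finset.in_set andbC.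
Qed.

(** Restricting to a value of the split keeps the data independent and
    identically distributed, because the split and the external randomness are
    jointly independent of the data. *)
Lemma product_law_given_split (R : realType) (dO dT dU : measure_display)
    (Omega : measurableType dO) (Pr : probability Omega R)
    (T : measurableType dT) (TU : measurableType dU) (I J : finType)
    (P : probability T R) (Z : I -> {RV Pr >-> T}) (U : {RV Pr >-> TU})
    (S : Omega -> {set J}) (A : {set J})
    (mA : measurable (S @^-1` [set A])) :
  iid P Z -> independent_of_data Z S U ->
  forall C B, measurable C -> (forall i, measurable (B i)) ->
  mrestr Pr mA (U @^-1` C `&` \bigcap_i (Z i @^-1` B i)) =
  (mrestr Pr mA (U @^-1` C) * \prod_i P (B i))%E.
Proof.
move=> [ZP Zind] indep C B mC mB; rewrite /mrestr.
rewrite [X in Pr X](_ : _ =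
    (\bigcap_i (Z i @^-1` B i)) `&` (S @^-1` [set A] `&` U @^-1` C)); last first.
  by rewrite setIAC setIC [U @^-1` C `&` _]setIC.
rewrite indep// muleC; congr (Pr _ * _)%E; first by rewrite setIC.
have := Zind [set i | true]%SET B mB.
rewrite (_ : [set` [set i | true]%SET] = setT); last first.
  by apply/seteqP; split=> // i _; rewrite /= inE.
move=> ->; apply: eq_big => [i|i _]; first by rewrite inE.
exact: ZP.
Qed.

(** * Coverage *)

Section one_split.
Context (R : realType) (d n : nat) (r s q : R).
Hypotheses (r_ge0 : 0 <= r) (s_ge0 : 0 <= s) (q01 : 0 < q < 1).
Local Notation T1 := (d.-tuple R).
Local Notation T := (d.-tuple R * R)%type.
Context (P : probability T R) (kappa : R.-pker T1 ~> R)
  (kappaP : is_cond_distribution P kappa)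
  (Quantile : T1 -> R) (QuantileP : is_cond_quantile kappa q Quantile)
  (dO : measure_display) (Omega : measurableType dO)
  (mu : {finite_measure set Omega -> \bar R})
  (Z : 'I_n.+1 -> {mfun Omega >-> T})
  (dU : measure_display) (TU : measurableType dU) (U : {mfun Omega >-> TU})
  (product_law : forall C B, measurable C -> (forall i, measurable (B i)) ->
     mu (U @^-1` C `&` \bigcap_i (Z i @^-1` B i)) =
     (mu (U @^-1` C) * \prod_i P (B i))%E)
  (rule_lo rule_hi : fitting_rule R d TU n)
  (rule_loP : is_fitting_rule rule_lo) (rule_hiP : is_fitting_rule rule_hi)
  (A : {set 'I_n}) (A_small : (0 < #|~: A|)%N).
Local Notation m := (#|~: A|%:R : R).

Definition covered : set Omega := [set w |
  split_prediction_set r s q rule_lo rule_hi A (U w) (training_sample Z w)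
    (Z ord_max w).1 (Quantile (Z ord_max w).1)].

(* The sign of the upper score is reversed so that on both sides a miss means
   that few calibration scores are small. *)
Let score_lo u (z : n.-tuple T) (t : T) := rule_lo A u z t.1 t.2.
Let score_hi u (z : n.-tuple T) (t : T) := - rule_hi A u z t.1 t.2.

Let miss_lo := count_event Z U A score_lo Quantile
  (fun k => ~~ (m * (r * q * (1 + m^-1) - m^-1) <= k%:R)).
Let miss_hi := count_event Z U A score_hi Quantile
  (fun k => ~~ (m - k%:R < m * ((1 - s * (1 - q)) * (1 + m^-1)))).

(** For the reversed upper score, the calibration scores counted are those
    complementary to the ones below [v] in [le_emp_quantile]. *)
Lemma coveredE : covered = ~` (miss_lo `|` miss_hi).
Proof.
have sizeE (f : 'I_n -> R) : size [seq f i | i <- enum (~: A)] = #|~: A|.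
  by rewrite size_map -cardE.
apply/funext => w; apply/propext; rewrite /covered /split_prediction_set /=.
rewrite emp_quantile_le le_emp_quantile !sizeE !count_map.
rewrite /miss_lo /miss_hi /count_event /= !card_set_count.
(* lo, hi come from the empirical quantiles, lo', hi' from the counts *)
set lo := (_ <= _%:R); set hi := (_ < _).
set lo' := (X in ~~ X \/ _); set hi' := (X in _ \/ ~~ X).
have -> : lo' = lo by [].
have -> : hi' = hi.
  rewrite /hi' /hi; congr (_ < _).
  rewrite cardE -(count_predC (preim (fun i => rule_hi A (U w)
    (training_sample Z w) (tnth (training_sample Z w) i).1
    (tnth (training_sample Z w) i).2) (fun e => e < rule_hi A (U w)
    (training_sample Z w) (Z ord_max w).1 (Quantile (Z ord_max w).1)))).
  rewrite natrD -[RHS]addr0 -addrA; congr (_ + _).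
  apply/eqP; rewrite subr_eq0; apply/eqP; congr _%:R.
  by apply: eq_count => i; rewrite /= /score_hi lerN2 leNgt.
by split=> [[-> ->] []//|/not_orP[/negP/negPn-> /negP/negPn->]].
Qed.

Let measurable_lo : measurable_fun setT
  (fun a : (TU * n.-tuple T) * T => score_lo a.1.1 a.1.2 a.2).
Proof. by have [/(_ A)] := rule_loP. Qed.

Let measurable_hi : measurable_fun setT
  (fun a : (TU * n.-tuple T) * T => score_hi a.1.1 a.1.2 a.2).
Proof.
have [/(_ A) mhi _ _] := rule_hiP.
exact: (measurableT_comp (@oppr_measurable _ _) mhi).
Qed.

Let measurable_Quantile : measurable_fun setT Quantile.
Proof. by have [] := QuantileP. Qed.

Let measurable_miss_lo : measurable miss_lo.
Proof. exact: (measurable_count_event Z U A measurable_lo measurable_Quantile). Qed.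

Let measurable_miss_hi : measurable miss_hi.
Proof. exact: (measurable_count_event Z U A measurable_hi measurable_Quantile). Qed.

Lemma measurable_covered : measurable covered.
Proof. by rewrite coveredE; apply: measurableC; exact: measurableU. Qed.

Let miss_lo_bound : (mu miss_lo <= r%:E * mu setT)%E.
Proof.
have [q0 q1] := andP q01.
have m0 : m != 0 by rewrite pnatr_eq0 -lt0n.
have mX : measurable_fun setT (fun t : T => Quantile t.1).
  exact: measurableT_comp.
apply: (@count_event_bound _ _ _ _ _ _ _ _ _ _ _ _ kappa _ _ _ product_law _ _
  _ _ _ [set t : T | t.2 <= Quantile t.1] q) => //.
- have [_ loc _] := rule_loP => u z z' zz'.
  by apply/funext => t; rewrite /score_lo (loc _ _ _ _ zz').
- by rewrite -[X in measurable X]setTI; exact: measurable_fun_le.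
- move=> x; have [_ /(_ x)[+ _]] := QuantileP.
  by rewrite xsectionE.
- by move=> u z x y /= yQ; have [_ _] := rule_loP; exact.
- move=> k; rewrite -ltNge => kr; rewrite -natr1.
  (* the correction 1/n2 of the level makes room for the test point *)
  have -> : r * q * (#|~: A|.+1)%:R = m * (r * q * (1 + m^-1) - m^-1) + 1.
    by rewrite -natr1; field.
  by rewrite lerD2r ltW.
Qed.

Let miss_hi_bound : (mu miss_hi <= s%:E * mu setT)%E.
Proof.
have [q0 q1] := andP q01.
have m0 : m != 0 by rewrite pnatr_eq0 -lt0n.
have mX : measurable_fun setT (fun t : T => Quantile t.1).
  exact: measurableT_comp.
apply: (@count_event_bound _ _ _ _ _ _ _ _ _ _ _ _ kappa _ _ _ product_law _ _
  _ _ _ [set t : T | Quantile t.1 <= t.2] (1 - q)) => //.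
- have [_ loc _] := rule_hiP => u z z' zz'.
  by apply/funext => t; rewrite /score_hi (loc _ _ _ _ zz').
- by rewrite -[X in measurable X]setTI; exact: measurable_fun_le.
- by rewrite subr_gt0.
- move=> x; have [_ /(_ x)[_ +]] := QuantileP.
  by rewrite xsectionE.
- by move=> u z x y /= yQ; rewrite /score_hi lerN2; have [_ _] := rule_hiP; exact.
- move=> k; rewrite -leNgt => kr; rewrite -natr1.
  have -> : s * (1 - q) * (#|~: A|.+1)%:R =
      m + 1 - m * ((1 - s * (1 - q)) * (1 + m^-1)).
    by rewrite -natr1; field.
  by lra.
Qed.

Lemma covered_bound : ((1 - (r + s))%:E * mu setT <= mu covered)%E.
Proof.
have mL : measurable (miss_lo `|` miss_hi) by exact: measurableU.
have fT : mu setT \is a fin_num by rewrite fin_num_measure.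
have -> : mu covered = (mu setT - mu (miss_lo `|` miss_hi))%E.
  rewrite coveredE -setTD measureD//; first by rewrite setTI.
  by rewrite ltey_eq fin_num_measure.
rewrite EFinB muleBl// mul1e leeB//.
rewrite EFinD ge0_muleDl ?lee_fin//.
apply: le_trans (leeD miss_lo_bound miss_hi_bound).
exact: measureU2.
Qed.

End one_split.

Theorem theorem2 (R : realType) (d n n1 n2 : nat) (alpha r s q : R)
  (d_ge1 : (1 <= d)%N) (alpha01 : 0 < alpha < 1)
  (r_ge0 : 0 <= r) (s_ge0 : 0 <= s) (rs_alpha : r + s = alpha)
  (q01 : 0 < q < 1)
  (n1_ge1 : (1 <= n1)%N) (n2_ge1 : (1 <= n2)%N) (n12 : (n1 + n2 = n)%N)
  (* the distribution P, the conditional law of Y given X, and its quantile *)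
  (P : probability (d.-tuple R * R)%type R)
  (kappa : R.-pker (d.-tuple R) ~> R) (kappaP : is_cond_distribution P kappa)
  (Quantile : d.-tuple R -> R) (QuantileP : is_cond_quantile kappa q Quantile)
  (* the data: indices < n are the training points, ord_max is the test point *)
  (dO : measure_display) (Omega : measurableType dO) (Pr : probability Omega R)
  (Z : 'I_n.+1 -> {RV Pr >-> (d.-tuple R * R)%type}) (Z_iid : iid P Z)
  (* the random split (I1 and its complement) and the external randomness *)
  (I1 : Omega -> {set 'I_n}) (I1_rand : random_subset I1)
  (card_I1 : forall w, #|I1 w| = n1)
  (dU : measure_display) (TU : measurableType dU) (U : {RV Pr >-> TU})
  (indep : independent_of_data Z I1 U)
  (rule_lo rule_hi : fitting_rule R d TU n)
  (rule_loP : is_fitting_rule rule_lo) (rule_hiP : is_fitting_rule rule_hi) :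
  let train w := [tuple Z (widen_ord (leqnSn n) i) w | i < n] in
  let X_test w := (Z ord_max w).1 in
  ((1 - alpha)%:E <=
   Pr [set w | split_prediction_set r s q rule_lo rule_hi
                 (I1 w) (U w) (train w) (X_test w) (Quantile (X_test w))])%E.
Proof.
cbv zeta; set G := [set w | _].
have GE (A : {set 'I_n}) : G `&` I1 @^-1` [set A] =
    covered r s q Quantile Z U rule_lo rule_hi A `&` I1 @^-1` [set A].
  by apply/seteqP; split=> w [Gw /= wA]; split=> //;
    [rewrite /covered -wA|rewrite /G /= wA].
have [a0 a1] := andP alpha01.
have small (A : {set 'I_n}) : #|A| = n1 -> (0 < #|~: A|)%N.
  by move=> cA; have := cardsC A; rewrite card_ord cA; lia.
have empty (A : {set 'I_n}) : #|A| <> n1 -> I1 @^-1` [set A] = set0.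
  by move=> cA; apply/seteqP; split=> // w wA; apply: cA; rewrite -wA card_I1.
apply: (probability_ge_fibers (S := I1)) => //; first by rewrite subr_ge0 ltW.
  move=> A; rewrite GE; apply: measurableI => //.
  exact: (measurable_covered r s QuantileP Z U rule_loP rule_hiP).
move=> A; have [cA|/empty ->] := pselect (#|A| = n1); last first.
  by rewrite setI0 measure0 mule0.
rewrite GE.
rewrite -rs_alpha -[in leLHS](setTI (I1 @^-1` [set A])).
exact: (covered_bound r_ge0 s_ge0 q01 kappaP QuantileP
  (product_law_given_split (I1_rand A) Z_iid indep) rule_loP rule_hiP
  (small A cA)).
Qed.
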